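(* Let $n,m\ge 2$ be two integers, and let $G$ and $H$ be finitely generated groups with normal subgroups $M\lhd G$, $N\lhd H$. Assume that $M$ is not co-amenable in $G$. If there exists a quasi-isometry of pairs $(G,M)\to (H,N)$ and if $n$ and $m$ have the same prime divisors, then there exists a quasi-isometry $$\mathbb{Z}_{n}\wr_{G/M}G\to \mathbb{Z}_{m}\wr_{H/N}H.$$
   Context: $\mathbb{Z}_n$ is the cyclic group of order $n$. Finitely generated groups are equipped with word metrics associated to finite generating sets. For groups $F,H$ and an action of $H$ on a set $X$, $F\wr_X H=\left(\bigoplus_X F\right)\rtimes H$, where $H$ permutes the coordinates; $H$ acts on $H/N$ by left multiplication. The subgroup $M$ is co-amenable in $G$ if the action of $G$ on $G/M$ by left multiplication admits an invariant mean (for $M$ normal: $G/M$ is amenable). Quasi-isometry of pairs: a quasi-isometry $f:G\to H$ is a quasi-isometry of pairs $(G,M)\to(H,N)$ if there is $Q>0$ such that for every left coset $gM$ there is a left coset $hN$ with $d_{\mathrm{Haus}}(f(gM),hN)\le Q$, and for every left coset $hN$ there is a left coset $gM$ with $d_{\mathrm{Haus}}(f(gM),hN)\le Q$. *)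

(* Defs.v *)
From HB Require Import structures.
From mathcomp Require Import all_boot all_order all_algebra all_fingroup finmap.
From mathcomp Require Import boolp classical_sets reals ereal.

Set Implicit Arguments.
Unset Strict Implicit.
Unset Printing Implicit Defensive.

Import Order.TTheory GRing.Theory Num.Theory.

Local Open Scope fset_scope.
Local Open Scope classical_set_scope.
Local Open Scope group_scope.

Section WordMetric.
Variable G : groupType.
Implicit Types (S : {fset G}) (g : G) (w : seq G).

Definition is_word S g w : Prop :=
  all (fun s => (s \in S) || (s^-1 \in S)) w /\ \prod_(s <- w) s = g.

Definition generates S : Prop := forall g, exists w, is_word S g w.

(* The value [0] outside of the subgroup generated by [S] is a dummy one. *)
Definition word_length S g : nat :=
  if pselect (exists k, `[< exists2 w, is_word S g w & size w = k >]) is left e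
  then ex_minn e else 0%N.

Definition word_dist (R : realType) S (x y : G) : R :=
  (word_length S (x^-1 * y))%:R%R.

End WordMetric.

Section CoarseGeometry.
Variable R : realType.
Local Open Scope ring_scope.

Definition quasi_isometry (X Y : Type) (dX : X -> X -> R) (dY : Y -> Y -> R)
    (f : X -> Y) : Prop :=
  exists C K : R, [/\ 1 <= C, 0 <= K,
    (forall x x', C^-1 * dX x x' - K <= dY (f x) (f x') <= C * dX x x' + K) &
    (forall y, exists x, dY (f x) y <= K)].

Definition nbhd (X : Type) (d : X -> X -> R) (r : R) (A : set X) : set X :=
  [set x | exists2 a, A a & d x a <= r].

Definition hausdorff_dist (X : Type) (d : X -> X -> R) (A B : set X) : \bar R :=
  ereal_inf [set r%:E | r in
    [set r : R | [/\ 0 <= r, A `<=` nbhd d r B & B `<=` nbhd d r A]]].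

End CoarseGeometry.

Section Cosets.
Variable G : groupType.
Implicit Types (M : set G) (g : G).

Definition normal_subgroup M : Prop :=
  group_closed [in M] /\ forall g x, M x -> M (x ^ g).

Definition left_coset M g : set G := [set g * x | x in M].

Definition cosets M : choiceType := set_type (range (left_coset M)).

End Cosets.

Definition quasi_isometry_of_pairs (R : realType) (G H : groupType)
    (dG : G -> G -> R) (M : set G) (dH : H -> H -> R) (N : set H)
    (f : G -> H) : Prop :=
  quasi_isometry dG dH f /\
  exists2 Q : R, (0 < Q)%R &
    (forall g, exists h,
      (hausdorff_dist dH (f @` left_coset M g) (left_coset N h) <= Q%:E)%E) /\
    (forall h, exists g,
      (hausdorff_dist dH (f @` left_coset M g) (left_coset N h) <= Q%:E)%E).

Record group_action (H : groupType) (X : Type) := GroupAction {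
  gact :> H -> X -> X;
  gact1 : forall x, gact 1 x = x;
  gactM : forall g h x, gact (g * h) x = gact g (gact h x) }.

Section CosetAction.
Variables (G : groupType) (M : set G).

Lemma left_mul_coset_subproof (g : G) (c : cosets M) :
  [set g * x | x in val c] \in range (left_coset M).
Proof.
case: c => A /= /set_mem[k _ <-]; apply/mem_set; exists (g * k) => //.
rewrite /left_coset; apply/seteqP; split=> [_ [x Mx <-]|_ [_ [x Mx <-] <-]].
  by exists (k * x); [exists x | rewrite mulgA].
by exists x; rewrite // mulgA.
Qed.

Definition left_mul_coset (g : G) (c : cosets M) : cosets M :=
  SigSub (left_mul_coset_subproof g c).

Lemma left_mul_coset1 c : left_mul_coset 1 c = c.
Proof.
apply: val_inj => /=; apply/seteqP; split=> [_ [x cx <-]|x cx].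
  by rewrite mul1g.
by exists x; rewrite ?mul1g.
Qed.

Lemma left_mul_cosetM g h c :
  left_mul_coset (g * h) c = left_mul_coset g (left_mul_coset h c).
Proof.
apply: val_inj => /=; apply/seteqP; split=> [_ [x cx <-]|_ [_ [x cx <-] <-]].
  by exists (h * x); [exists x | rewrite mulgA].
by exists x; rewrite // mulgA.
Qed.

Definition coset_action : group_action G (cosets M) :=
  GroupAction left_mul_coset1 left_mul_cosetM.

End CosetAction.

Section Amenability.
Local Open Scope ring_scope.

Definition bounded_function (R : realType) (X : Type) (f : X -> R) : Prop :=
  exists C : R, forall x, `|f x| <= C.

(* [mean] is only meaningful on bounded functions. *)
Definition invariant_mean (R : realType) (H : groupType) (X : Type)
    (a : group_action H X) (mean : (X -> R) -> R) : Prop :=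
  [/\ (forall (t : R) f g, bounded_function f -> bounded_function g ->
        mean (fun x => t * f x + g x) = t * mean f + mean g),
      (forall f, bounded_function f -> (forall x, 0 <= f x) -> 0 <= mean f),
      mean (fun=> 1) = 1 &
      (forall h f, bounded_function f -> mean (fun x => f (a h x)) = mean f)].

Definition co_amenable (R : realType) (G : groupType) (M : set G) : Prop :=
  exists mean : (cosets M -> R) -> R, invariant_mean (coset_action M) mean.

End Amenability.

Section Wreath.
Variables (F : groupType) (X : choiceType) (H : groupType).

Definition wreath of group_action H X : Type :=
  ({fsfun X -> F with 1} * H)%type.

Variable a : group_action H X.
Local Notation W := (wreath a).
Implicit Types u v w : W.

HB.instance Definition _ := Choice.copy W ({fsfun X -> F with 1} * H)%type.

Definition wreath_one : W := ([fsfun], 1).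

(* [(u v)_x = u_x v_(h^-1 x)] for [(u, h) (v, k)]: the group [H] acts on the
   direct sum by [(h v)_x = v_(h^-1 x)]. *)
Definition wreath_mul u v : W :=
  ([fsfun x in (finsupp u.1 `|` [fset a u.2 y | y in finsupp v.1])%fset
      => u.1 x * v.1 (a u.2^-1 x)], u.2 * v.2).

Definition wreath_inv u : W :=
  ([fsfun x in [fset a u.2^-1 y | y in finsupp u.1]%fset => (u.1 (a u.2 x))^-1],
   u.2^-1).

Lemma gactK h : cancel (a h) (a h^-1).
Proof. by move=> x; rewrite -gactM mulVg gact1. Qed.

Lemma gactVK h : cancel (a h^-1) (a h).
Proof. by move=> x; rewrite -gactM mulgV gact1. Qed.

Lemma wreath_mulE u v x : (wreath_mul u v).1 x = u.1 x * v.1 (a u.2^-1 x).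
Proof.
rewrite fsfunE; case: ifPn => //; rewrite inE negb_or => /andP[ux vx].
rewrite (fsfun_dflt ux) mul1g; case: finsuppP => // vx'.
case/imfsetP: vx; exists (a u.2^-1 x) => //.
by rewrite gactVK.
Qed.

Lemma wreath_invE u x : (wreath_inv u).1 x = (u.1 (a u.2 x))^-1.
Proof.
rewrite fsfunE; case: ifPn => // ux; case: finsuppP => [_|ux'].
  by rewrite invg1.
case/imfsetP: ux; exists (a u.2 x) => //.
by rewrite gactK.
Qed.

Lemma wreath_eq u v : u.1 =1 v.1 -> u.2 = v.2 -> u = v.
Proof. by case: u v => [u h] [v k] /= /fsfunP -> ->. Qed.

Lemma wreath_mulA : associative wreath_mul.
Proof.
move=> u v w; apply: wreath_eq => [x|/=]; last by rewrite mulgA.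
by rewrite !wreath_mulE /= invMg gactM mulgA.
Qed.

Lemma wreath_mul1g : left_id wreath_one wreath_mul.
Proof.
move=> u; apply: wreath_eq => [x|/=]; last by rewrite mul1g.
by rewrite wreath_mulE /= fsfunE mul1g invg1 gact1.
Qed.

Lemma wreath_mulg1 : right_id wreath_one wreath_mul.
Proof.
move=> u; apply: wreath_eq => [x|/=]; last by rewrite mulg1.
by rewrite wreath_mulE /= fsfunE mulg1.
Qed.

Lemma wreath_mulVg : left_inverse wreath_one wreath_inv wreath_mul.
Proof.
move=> u; apply: wreath_eq => [x|/=]; last by rewrite mulVg.
by rewrite wreath_mulE wreath_invE /= fsfunE invgK mulVg.
Qed.

Lemma wreath_mulgV : right_inverse wreath_one wreath_inv wreath_mul.
Proof.
move=> u; apply: wreath_eq => [x|/=]; last by rewrite mulgV.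
by rewrite wreath_mulE wreath_invE /= fsfunE gactVK mulgV.
Qed.

HB.instance Definition _ := isGroup.Build W
  wreath_mulA wreath_mul1g wreath_mulg1 wreath_mulVg wreath_mulgV.

End Wreath.

Arguments wreath F {X H} a.

Definition lamplighter (n : nat) (G : groupType) (M : set G) : groupType :=
  wreath 'Z_n (coset_action M).

Section Generation.
Variable G : groupType.
Implicit Types S : {fset G}.

Definition spanned S (g : G) : Prop := exists w, is_word S g w.

Lemma spanned1 S : spanned S 1.
Proof. by exists [::]; split; rewrite ?big_nil. Qed.

Lemma spannedM S g h : spanned S g -> spanned S h -> spanned S (g * h).
Proof.
move=> [v [vS <-]] [w [wS <-]]; exists (v ++ w).
by split; rewrite ?all_cat ?vS ?big_cat.
Qed.

Lemma spanned_gen S s : s \in S -> spanned S s.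
Proof. by move=> sS; exists [:: s]; split; rewrite ?big_seq1 //= sS. Qed.

Lemma spanned_genV S s : s^-1 \in S -> spanned S s.
Proof. by move=> sS; exists [:: s]; split; rewrite ?big_seq1 //= sS orbT. Qed.

End Generation.

Lemma generates_morph (G K : groupType) (S : {fset G}) (U : {fset K})
    (f : G -> K) : f 1 = 1 -> {morph f : x y / x * y} ->
  (forall s, s \in S -> f s \in U) -> generates S -> forall g, spanned U (f g).
Proof.
move=> f1 fM fS Sgen g; have [w [wS <-]] := Sgen g.
elim: w wS => [_|s w IHw /= /andP[sS wS]]; first by rewrite big_nil f1; apply: spanned1.
rewrite big_cons fM; apply: spannedM; last exact: IHw.
case/orP: sS => [/fS|/fS sU]; first exact: spanned_gen.
apply: spanned_genV; suff -> : (f s)^-1 = f s^-1 by [].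
by apply: (@mulgI _ (f s)); rewrite -fM !mulgV f1.
Qed.

Section WreathGeneration.
Variables (F : groupType) (X : choiceType) (H : groupType).
Variables (a : group_action H X) (x0 : X).
Local Notation W := (wreath F a).

Definition wreath_lamp (x : X) (c : F) : W := ([fsfun y in [fset x]%fset => c], 1).

Definition wreath_base (h : H) : W := ([fsfun], h).

Lemma wreath_lampE x c y : (wreath_lamp x c).1 y = if y == x then c else 1.
Proof. by rewrite fsfunE inE. Qed.

Lemma wreath_lampM x : {morph wreath_lamp x : c d / c * d}.
Proof.
move=> c d; apply: wreath_eq => [y|/=]; last by rewrite mulg1.
rewrite wreath_mulE !wreath_lampE /= invg1 gact1.
by case: eqP; rewrite ?mulg1.
Qed.

Lemma wreath_lamp1 x : wreath_lamp x 1 = 1.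
Proof.
by apply: wreath_eq => // y; rewrite wreath_lampE fsfunE; case: eqP.
Qed.

Lemma wreath_baseM : {morph wreath_base : g h / g * h}.
Proof.
by move=> g h; apply: wreath_eq => [y|//]; rewrite wreath_mulE !fsfunE mulg1.
Qed.

Lemma wreath_lamp_conj h c :
  wreath_lamp (a h x0) c = wreath_base h * wreath_lamp x0 c * wreath_base h^-1.
Proof.
apply: wreath_eq => [y|/=]; last by rewrite mulg1 mulgV.
rewrite !wreath_mulE !fsfunE !inE /= mul1g mulg1 (can2_eq (gactVK a h) (gactK a h)) //.
Qed.

Lemma wreath_fg (A : {fset F}) (S : {fset H}) :
  generates A -> generates S -> (forall x, exists h, x = a h x0) ->
  exists U : {fset W}, generates U.
Proof.
move=> Agen Sgen trans.
exists ([fset wreath_lamp x0 c | c in A] `|` [fset wreath_base s | s in S])%fset.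
set U := (_ `|` _)%fset.
have baseU h : spanned U (wreath_base h).
  apply: (generates_morph _ wreath_baseM _ Sgen) => // s sS.
  by rewrite inE; apply/orP; right; apply/imfsetP; exists s.
have lamp0U c : spanned U (wreath_lamp x0 c).
  apply: (generates_morph (wreath_lamp1 _) (@wreath_lampM _) _ Agen) => s sA.
  by rewrite inE; apply/orP; left; apply/imfsetP; exists s.
have lampU x c : spanned U (wreath_lamp x c).
  by have [h ->] := trans x; rewrite wreath_lamp_conj; do !apply: spannedM.
suff confU (r : seq X) (u : W) : u.2 = 1 -> (forall x, x \notin r -> u.1 x = 1) ->
    spanned U u.
  case=> u h; rewrite -/(spanned U _).
  have -> : (u, h) = ((u, 1) : W) * wreath_base h.
    by apply: wreath_eq => [x|/=]; rewrite ?mul1g // wreath_mulE fsfunE mulg1.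
  apply: spannedM (baseU h); apply: (confU (finsupp u)) => //= x.
  exact: fsfun_dflt.
elim: r u => [|x r IHr] u u2 ur.
  suff -> : u = 1 by apply: spanned1.
  by apply: wreath_eq => // x; rewrite fsfunE ur.
pose v : W := wreath_lamp x (u.1 x)^-1 * u.
have -> : u = wreath_lamp x (u.1 x) * v.
  by rewrite /v mulgA -wreath_lampM mulgV wreath_lamp1 mul1g.
apply: spannedM (lampU _ _) _; apply: IHr => [|y yr]; first by rewrite /= mul1g.
rewrite wreath_mulE wreath_lampE /= invg1 gact1.
by case: eqP => [->|/eqP yx]; rewrite ?mulVg // mul1g ur // inE negb_or yx.
Qed.

End WreathGeneration.

Lemma lamplighter_fg (n : nat) (G : groupType) (M : set G) (S : {fset G}) :
  generates S -> exists U : {fset lamplighter n M}, generates U.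
Proof.
move=> Sgen; have M1 : left_coset M 1 \in range (left_coset M).
  by apply/mem_set; exists 1.
apply: (@wreath_fg _ _ _ _ (SigSub M1 : cosets M)
          [fset c | c in enum 'Z_n]%fset S _ Sgen) => [c|x].
  by apply: spanned_gen; rewrite !inE /= mem_enum.
have /set_mem[g _ gx] := valP x; exists g; apply: val_inj => /=.
rewrite -gx; apply/seteqP; split=> [_ [y My <-]|_ [_ [y My <-] <-]].
  by exists y; [exists y; rewrite ?mul1g|].
by exists y; rewrite // mul1g.
Qed.

(* Main.v *)
(** Idea. Each lamp group is identified, as a pointed set, with the product of
    the cyclic groups attached to the prime factors of its order, counted with
    multiplicity; a lamp configuration on [G/M] becomes a finitely supported
    function on [G/M * I], where [I] indexes these factors.  The map induced by
    [f] on cosets is a coarse equivalence [fb : G/M -> H/N].  As [M] is not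
    co-amenable, finite subsets of [G/M] expand by arbitrary factors, so Hall's
    marriage theorem, followed by Cantor-Bernstein, gives a bijection
    [h : G/M * I -> H/N * J] that preserves the primes and whose first component
    is at bounded distance from [fb].  Transporting configurations along [h] and
    the cursor along [f] is then the desired quasi-isometry.

    Distances are avoided as follows: two maps into a finitely generated group
    are at bounded distance when the quotients of their values range over a
    finite set, and likewise for a set on which the group acts. *)
From mathcomp Require Import all_boot all_order all_algebra all_fingroup finmap.
From mathcomp Require Import zify.
From mathcomp Require Import boolp classical_sets reals ereal.
From mathcomp Require Import filter topology normedtype sequences.
Require Import Defs.

Set Implicit Arguments.
Unset Strict Implicit.
Unset Printing Implicit Defensive.

Import Order.TTheory GRing.Theory Num.Theory.
Import numFieldNormedType.Exports.

Local Open Scope fset_scope.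
Local Open Scope classical_set_scope.
Local Open Scope group_scope.

(** * Infinite matchings *)

Section Hall.
Variables (I Y : choiceType).
Implicit Types (A : {fset I}) (F : I -> {fset Y}).

Definition hall F : Prop := forall A, #|` A| <= #|` \bigcup_(i <- A) F i|.

(** [D] is a set of deleted edges of the bipartite graph given by [F]. Recording deletions rather
    than survivors makes unions of chains the upper bounds that Zorn's lemma asks for. *)
Let prune F (D : set (I * Y)) (i : I) : {fset Y} :=
  [fset y in F i | `[< ~ D (i, y) >]]%fset.

Let pruneP F D i y : reflect (y \in F i /\ ~ D (i, y)) (y \in prune F D i).
Proof. by rewrite !inE /=; apply: (iffP andP) => -[? /asboolP]. Qed.

Let eq_hall F F' A : (forall i, i \in A -> F i = F' i) ->
  (\bigcup_(i <- A) F i = \bigcup_(i <- A) F' i)%fset.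
Proof. by move=> FF'; apply: eq_big_seq => i /FF'. Qed.

Let mem_nbrs F A k y : k \in A -> y \in F k -> y \in (\bigcup_(i <- A) F i)%fset.
Proof. by move=> kA Fy; apply/bigfcupP; exists k; rewrite ?kA. Qed.

(** Hall's condition at [A] involves only the finitely many edges leaving [A]. Those deleted by the
    union of a nonempty chain are, by totality, all deleted by a single member. *)
Let hall_chain F (C : set (set (I * Y))) : hall F ->
  C `<=` [set D | hall (prune F D)] -> total_on C subset ->
  hall (prune F (\bigcup_(D in C) D)).
Proof.
move=> hF hC totC A; set U := \bigcup_(D in C) D.
have [[D0 CD0]|C0] := pselect (C !=set0); last first.
  rewrite (@eq_hall _ F) // => i _; apply/fsetP => y.
  by apply/pruneP/idP => [[]|Fy]//; split=> // -[D CD]; case: C0; exists D.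
pose s := [seq (i, y) | i <- A, y <- prune F (~` U) i].
have sU z : z \in s -> U z.
  case/allpairsPdep => i [y [_ /pruneP[_ /contrapT Uy] ->]].
  exact: Uy.
have [D CD sD] : exists2 D, C D & forall z, z \in s -> D z.
  elim: s sU => [|z s IH] sU; first by exists D0.
  have [|D CD sD] := IH; first by move=> t ts; apply: sU; rewrite inE ts orbT.
  have [|D' CD' D'z] := sU z; first by rewrite inE eqxx.
  have [DD'|D'D] := totC _ _ CD CD'.
    by exists D' => // t; rewrite inE => /predU1P[->//|/sD/DD'].
  by exists D => // t; rewrite inE => /predU1P[->|/sD//]; apply: D'D.
rewrite (@eq_hall _ (prune F D)) => [|i Ai]; first exact: hC.
apply/fsetP => y; apply/pruneP/pruneP => -[Fy nDy]; split=> //.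
  by move=> Dy; apply: nDy; exists D.
move=> Uy; apply: nDy; apply: sD; apply/allpairsPdep; exists i, y; split=> //.
by apply/pruneP; split=> //; apply.
Qed.

(* Submodularity of [A |-> #|N(A)|]: of two distinct elements of [F i], at least
   one can be removed without violating Hall's condition. *)
Let hall_remove F i y y' : hall F -> y \in F i -> y' \in F i -> y != y' ->
  hall (prune F [set (i, y)]) \/ hall (prune F [set (i, y')]).
Proof.
move=> hF Fy Fy' yy'; apply: contrapT => /not_orP[].
(* A violation caused by deleting [(i, z)] comes from a set containing [i]; setting [i] aside turns
   the strict inequality into a weak one. *)
have key z : ~ hall (prune F [set (i, z)]) -> exists2 A : {fset I},
    i \notin A & #|` (\bigcup_(k <- A) F k `|` (F i `\ z))%fset| <= #|` A|.
  move=> /existsNP[A /negP]; rewrite -ltnNge => ltA.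
  have Ai : i \in A.
    apply: contraLR ltA => iA; rewrite -leqNgt (@eq_hall _ F) // => k kA.
    apply/fsetP => w; apply/pruneP/idP => [[]|Fw]//; split=> // -[ki _].
    by rewrite -ki kA in iA.
  exists (A `\ i)%fset; first by rewrite !inE eqxx.
  rewrite -ltnS; move: ltA; rewrite [X in _ < X](cardfsD1 i) Ai add1n.
  apply: leq_ltn_trans; apply: fsubset_leq_card; apply/fsubsetP => w.
  rewrite inE => /orP[/bigfcupP[k /andP[]]|].
    rewrite !inE => /andP[ki kA] _ Fw; apply/bigfcupP; exists k; rewrite ?kA //.
    by apply/pruneP; split=> // -[/eqP]; rewrite (negPf ki).
  rewrite !inE => /andP[wz Fw]; apply/bigfcupP; exists i; rewrite ?Ai //.
  by apply/pruneP; split=> // -[/eqP]; rewrite (negPf wz).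
move=> /key[A Ai cA] /key[A' A'i cA'].
(* As [y != y'], the two neighbourhoods together cover [F i]. Their union contains all neighbours of
   [i], [A] and [A'], and their intersection those of the common part of [A] and [A']; Hall's
   condition on both exceeds the sum by one. *)
have := leq_add cA cA'; rewrite -cardfsUI -[X in _ <= X]cardfsUI leqNgt.
apply/negP/negPn; rewrite -addSn; apply: leq_add.
  have -> : #|` (A `|` A')%fset|.+1 = #|` (i |` (A `|` A'))%fset|.
    by rewrite cardfsU1 !inE negb_or Ai A'i.
  apply: leq_trans (hF _) _; apply: fsubset_leq_card; apply/fsubsetP => w.
  case/bigfcupP => k /andP[]; rewrite !inE => kA _ Fw.
  case/or3P: kA => [/eqP ki|kA|kA'].
  - rewrite -ki Fw !andbT; have [->|wy] := eqVneq w y; first by rewrite yy' !orbT.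
    by rewrite !orbT.
  - by rewrite (mem_nbrs kA Fw).
  - by rewrite (mem_nbrs kA' Fw) !orbT.
apply: leq_trans (hF _) _; apply: fsubset_leq_card; apply/fsubsetP => w.
case/bigfcupP => k /andP[]; rewrite !inE => /andP[kA kA'] _ Fw.
by rewrite (mem_nbrs kA Fw) (mem_nbrs kA' Fw).
Qed.

(** A maximal set of deletions leaves exactly one neighbour per vertex: at least one by Hall on
    singletons, at most one by [hall_remove]. Injectivity is Hall on pairs. *)
Lemma hall_marriage F : hall F ->
  exists2 t : I -> Y, injective t & forall i, t i \in F i.
Proof.
move=> hF; have [D [/= hD maxD]] :=
    @Zorn_bigcup _ [set D | hall (prune F D)] (fun C => hall_chain hF).
have prune1 i y y' : y \in prune F D i -> y' \in prune F D i -> y = y'.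
  move=> Dy Dy'; apply/eqP/negPn/negP => yy'.
  suff absurd z : z \in prune F D i -> ~ hall (prune (prune F D) [set (i, z)]).
    by have [] := hall_remove hD Dy Dy' yy'; exact: absurd.
  move=> /pruneP[Fz Dz] hz; apply: (maxD (D `|` [set (i, z)])).
    split=> [|DD]; first by move=> w; left.
    by apply: Dz; apply: DD; right.
  move: hz; rewrite /mkset /hall => hz A; apply: leq_trans (hz A) _.
  rewrite leq_eqVlt; apply/predU1P; left; congr #|` _|; apply: eq_hall => k _.
  apply/fsetP => w; apply/pruneP/pruneP.
    by case=> /pruneP[Fw Dw] zw; split=> // -[].
  by case=> Fw /not_orP[Dw zw]; split=> //; apply/pruneP.
have /choice[t tP] i : exists y, y \in prune F D i.
  apply/fset0Pn; rewrite -cardfs_gt0; have := hD [fset i]%fset.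
  by rewrite cardfs1 big_seq_fset1.
exists t => [i k tik|i]; last by have /pruneP[] := tP i.
apply/eqP/negPn/negP => ik; have := hD [fset i; k]%fset.
rewrite leqNgt cardfs2 ik ltnS /= => /negP; apply.
rewrite -(cardfs1 (t i)); apply: fsubset_leq_card; apply/fsubsetP => w.
case/bigfcupP => l /andP[/fset2P[] -> _] Dw; apply/fset1P.
  exact: prune1 Dw (tP i).
by rewrite tik; exact: prune1 Dw (tP k).
Qed.

End Hall.

(** Take [f] on the set [C] of points reached by iterating [g \o f] from outside the range of [g],
    and the inverse of [g] elsewhere. The last clause is what lets [h] inherit metric control from
    [f] and [g]. *)
Lemma cantor_bernstein_pointwise (T U : Type) (f : T -> U) (g : U -> T) :
  injective f -> injective g ->
  exists (h : T -> U) (k : U -> T),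
    [/\ cancel h k, cancel k h & forall t, h t = f t \/ g (h t) = t].
Proof.
move=> injf injg.
pose C t := exists n t0, (forall u, g u <> t0) /\ t = iter n (g \o f) t0.
have CS t : C t -> C (g (f t)).
  by move=> [n [t0 [t0P ->]]]; exists n.+1, t0.
have /choice[h hP] t : exists u, (C t /\ u = f t) \/ (~ C t /\ g u = t).
  have [Ct|nCt] := pselect (C t); first by exists (f t); left.
  have [[u <-]|ng] := pselect (exists u, g u = t).
    have [Cgu|] := pselect (C (g u)); first by exists (f (g u)); left.
    by exists u; right.
  by case: nCt; exists 0%N, t; split=> // u gu; apply: ng; exists u.
have /choice[k kP] u : exists t, h t = u.
  have [Cgu|nCgu] := pselect (C (g u)); last first.
    by exists (g u); have [[/nCgu]|[_ /injg]] := hP (g u).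
  case: (Cgu) => -[|n] [t0 [t0P]] /= gu; first by case: (t0P u).
  have Ct : C (iter n (g \o f) t0) by exists n, t0.
  exists (iter n (g \o f) t0); have [[_ ->]|[]//] := hP (iter n (g \o f) t0).
  exact/injg/esym.
have injh : injective h.
  move=> t t' htt'; have := hP t; have := hP t'; rewrite -htt'.
  case=> [[Ct' ft']|[Ct' gt']] [[Ct ft]|[Ct gt]].
  - by apply: injf; rewrite -ft.
  - by case: Ct; rewrite -gt ft'; apply: CS.
  - by case: Ct'; rewrite -gt' ft; apply: CS.
  - by rewrite -gt.
exists h, k; split=> // [t|t]; first exact: injh.
by have [[_ ->]|[_ ->]] := hP t; [left | right].
Qed.

(** * Closeness and word metrics *)

Section Close.
Variables (G : groupType) (X : Type) (a : group_action G X).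

Definition close (T : Type) (u v : T -> X) : Prop :=
  exists E : seq G, forall t, exists2 e, e \in E & v t = a e (u t).

Lemma close_sym T (u v : T -> X) : close u v -> close v u.
Proof.
move=> [E uv]; exists [seq e^-1 | e <- E] => t; have [e Ee ->] := uv t.
by exists e^-1; [apply: (map_f (fun e => e^-1)) | rewrite -gactM mulVg gact1].
Qed.

Lemma close_trans T (v u w : T -> X) : close u v -> close v w -> close u w.
Proof.
move=> [E uv] [E' vw]; exists [seq e' * e | e' <- E', e <- E] => t.
have [e Ee ve] := uv t; have [e' Ee' we] := vw t.
by exists (e' * e); [apply: allpairs_f | rewrite gactM -ve].
Qed.

Lemma close_comp T T' (k : T' -> T) (u v : T -> X) :
  close u v -> close (u \o k) (v \o k).
Proof. by move=> [E uv]; exists E => t; apply: uv. Qed.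

Lemma close_act e : close id (a e).
Proof. by exists [:: e] => t; exists e; rewrite ?inE. Qed.

End Close.

Section Coarse.
Variables (G H : groupType) (X Y : Type).
Variables (a : group_action G X) (b : group_action H Y).

Definition coarse (f : X -> Y) : Prop := forall e, close b f (f \o a e).

(** The finite list of displacements is treated one element at a time and the resulting lists are
    concatenated, so the bound stays uniform in [t]. *)
Lemma coarse_close f T (u v : T -> X) : coarse f -> close a u v ->
  close b (f \o u) (f \o v).
Proof.
move=> fc [E uv].
have [E' fE] : exists E' : seq H, forall x e, e \in E ->
    exists2 e', e' \in E' & f (a e x) = b e' (f x).
  elim: E {u v uv} => [|e E [E' fE]]; first by exists [::].
  have [Ee fe] := fc e; exists (Ee ++ E') => x e'; rewrite inE => /predU1P[->|Ee'].
    by have [k kE fx] := fe x; exists k; rewrite -?fx // mem_cat kE.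
  by have [k kE ->] := fE x _ Ee'; exists k; rewrite // mem_cat kE orbT.
exists E' => t; have [e Ee /= ->] := uv t; exact: fE.
Qed.

End Coarse.

(* Right multiplication, whose orbits of finite sets are the balls of the
   left-invariant word metrics, as a left action. *)
Section RightMul.
Variable G : groupType.

Let rmul (g x : G) := x * g^-1.
Let rmul1 x : rmul 1 x = x. Proof. by rewrite /rmul invg1 mulg1. Qed.
Let rmulM g h x : rmul (g * h) x = rmul g (rmul h x).
Proof. by rewrite /rmul invMg mulgA. Qed.

Definition rmul_action : group_action G G := GroupAction rmul1 rmulM.

End RightMul.

Notation near := (close (rmul_action _)).
Notation coarse_map := (coarse (rmul_action _) (rmul_action _)).

Lemma nearP (G : groupType) (T : Type) (u v : T -> G) :
  near u v <-> exists E : seq G, forall t, (u t)^-1 * v t \in E.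
Proof.
split=> [] [E uv].
  exists [seq e^-1 | e <- E] => t; have [e Ee ->] := uv t.
  by rewrite /= mulKg (map_f (fun e => e^-1)).
exists [seq e^-1 | e <- E] => t; exists ((u t)^-1 * v t)^-1;
  first exact: (map_f (fun e => e^-1)).
by rewrite /= invgK mulgA mulgV mul1g.
Qed.

Lemma coarse_mapP (G H : groupType) (f : G -> H) : coarse_map f <->
  forall s, exists E : seq H, forall g, (f g)^-1 * f (g * s) \in E.
Proof.
split=> fc s; first by have /nearP[E fE] := fc s^-1; exists E => g;
  have := fE g; rewrite /= invgK.
by have [E fE] := fc s^-1; apply/nearP; exists E => g; apply: fE.
Qed.

Section WordLength.
Variables (G : groupType) (S : {fset G}).
Hypothesis Sgen : generates S.

Lemma word_lengthP g : exists2 w, is_word S g w & size w = word_length S g.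
Proof.
rewrite /word_length; case: pselect => [e|[]]; last first.
  by have [w wS] := Sgen g; exists (size w); apply/asboolP; exists w.
by case: ex_minnP => k /asboolP[w wS wk] _; exists w.
Qed.

Lemma word_length_le g w : is_word S g w -> word_length S g <= size w.
Proof.
move=> wS; rewrite /word_length; case: pselect => // e.
by case: ex_minnP => k _; apply; apply/asboolP; exists w.
Qed.

Lemma word_length1 : word_length S 1 = 0%N.
Proof.
apply/eqP; rewrite -leqn0; apply: (@word_length_le _ [::]).
by split; rewrite ?big_nil.
Qed.

Lemma word_lengthM g h :
  word_length S (g * h) <= word_length S g + word_length S h.
Proof.
have [v [vS <-] <-] := word_lengthP g; have [w [wS <-] <-] := word_lengthP h.
rewrite -size_cat; apply: word_length_le.
by split; rewrite ?all_cat ?vS ?big_cat.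
Qed.

(** Only finitely many words of bounded length exist over [S] and its inverses; this turns bounded
    distances into finite lists of quotients. *)
Lemma word_length_ball k :
  exists E : seq G, forall g, word_length S g <= k -> g \in E.
Proof.
suff [E EP] : exists E : seq G, forall w g,
    is_word S g w -> size w <= k -> g \in E.
  by exists E => g gk; have [w wS wg] := word_lengthP g; apply: EP wS _; rewrite wg.
elim: k => [|k [E EP]].
  by exists [:: 1] => -[|//] g [_ <-] _; rewrite big_nil inE.
exists (1 :: [seq s * g | s <- S ++ [seq s^-1 | s <- S], g <- E]).
move=> [|s w] g [wS <-]; first by rewrite big_nil inE eqxx.
rewrite big_cons inE => wk; apply/orP; right.
case/andP: wS => sS wS; apply: allpairs_f; last exact: EP wk.
rewrite mem_cat; case/orP: sS => [->//|sS]; apply/orP; right.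
by apply/mapP; exists s^-1; rewrite ?invgK.
Qed.

Lemma word_length_seq (E : seq G) :
  exists k, forall g, g \in E -> word_length S g <= k.
Proof.
elim: E => [|e E [k kE]]; first by exists 0%N.
exists (word_length S e + k)%N => g; rewrite inE => /predU1P[->|/kE].
  exact: leq_addr.
by move=> gk; apply: leq_trans gk (leq_addl _ _).
Qed.

Lemma near_word_length (T : Type) (u v : T -> G) : near u v <->
  exists k, forall t, word_length S ((u t)^-1 * v t) <= k.
Proof.
split=> [/nearP[E uv]|[k uv]].
  by have [k kE] := word_length_seq E; exists k => t; apply: kE.
by apply/nearP; have [E EP] := word_length_ball k; exists E => t; apply: EP.
Qed.

End WordLength.

(** A shortest word from [x] to [y] is followed letter by letter; each letter costs at most the
    worst displacement [C] over the finitely many generators and their inverses. *)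
Lemma coarse_map_lipschitz (G H : groupType) (S : {fset G}) (T : {fset H})
    (f : G -> H) : generates S -> generates T -> coarse_map f ->
  exists C : nat, forall x y,
    word_length T ((f x)^-1 * f y) <= C * word_length S (x^-1 * y).
Proof.
move=> Sgen Tgen /coarse_mapP fc.
have [C CP] : exists C : nat, forall s x, (s \in S) || (s^-1 \in S) ->
    word_length T ((f x)^-1 * f (x * s)) <= C.
  suff [C CP] : exists C : nat, forall s, s \in S ++ [seq s^-1 | s <- S] ->
      forall x, word_length T ((f x)^-1 * f (x * s)) <= C.
    exists C => s x sS; apply: CP; rewrite mem_cat.
    by case/orP: sS => [->//|/(map_f (fun s => s^-1))]; rewrite invgK orbC => ->.
  elim: (_ ++ _) => [|s r [C CP]]; first by exists 0%N.
  have [E fE] := fc s; have [k kE] := word_length_seq T E.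
  exists (k + C)%N => s'; rewrite inE => /predU1P[->|/CP Cs] x.
    by apply: leq_trans (kE _ (fE x)) (leq_addr _ _).
  by apply: leq_trans (Cs x) (leq_addl _ _).
exists C => x y; have [w [wS wxy] <-] := word_lengthP Sgen (x^-1 * y).
have -> : y = x * \prod_(s <- w) s by rewrite wxy mulgA mulgV mul1g.
elim: w wS x {wxy} => [|s w IH] /= wS x.
  by rewrite big_nil mulg1 mulVg word_length1.
case/andP: wS => sS wS; rewrite big_cons mulgA mulnS.
set z := x * s * _.
have -> : (f x)^-1 * f z = ((f x)^-1 * f (x * s)) * ((f (x * s))^-1 * f z).
  by rewrite -mulgA; congr (_ * _); rewrite mulgA mulgV mul1g.
by apply: leq_trans (word_lengthM Tgen _ _) (leq_add (CP _ _ sS) (IH wS _)).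
Qed.

Lemma word_dist_near (R : realType) (G : groupType) (S : {fset G}) (I : Type)
    (u v : I -> G) (r : R) : generates S ->
  (forall t, word_dist R S (u t) (v t) <= r)%R -> near u v.
Proof.
move=> Sgen uv; apply/(near_word_length Sgen).
exists (Num.bound `|r|%R) => t; rewrite -(ler_nat R); apply: le_trans (uv t) _.
by apply: le_trans (ler_norm _) (ltW (archi_boundP (normr_ge0 _))).
Qed.

Lemma near_word_dist (R : realType) (G : groupType) (S : {fset G}) (I : Type)
    (u v : I -> G) : generates S -> near u v ->
  exists r : R, forall t, (word_dist R S (u t) (v t) <= r)%R.
Proof.
move=> Sgen /(near_word_length Sgen)[k uv]; exists k%:R%R => t.
by rewrite ler_nat.
Qed.

Section QuasiIsometry.
Variables (R : realType) (G H : groupType) (S : {fset G}) (T : {fset H}).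
Hypotheses (Sgen : generates S) (Tgen : generates T).

(** The lower bound applies the Lipschitz bound of [f'] to [f x] and [f x'], then returns to [x] and
    [x'] because [f' \o f] is near the identity. *)
Lemma coarse_equivalence_qi (f : G -> H) (f' : H -> G) :
  coarse_map f -> coarse_map f' -> near (f' \o f) id -> near (f \o f') id ->
  quasi_isometry (word_dist R S) (word_dist R T) f.
Proof.
move=> fc f'c f'f.
have [C fC] := coarse_map_lipschitz Sgen Tgen fc.
have [C' f'C] := coarse_map_lipschitz Tgen Sgen f'c.
 have [k1 kf'f] := (near_word_length Sgen _ _).1 f'f.
have [k2 kf'f'] := (near_word_length Sgen _ _).1 (close_sym f'f).
move=> /(near_word_length Tgen)[k3 kff'].
(* The summand 1 gives [1 <= D], so that [D * K] absorbs the displacements [k1] and [k2]; [k3]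
   serves coarse surjectivity. *)
pose D := (C + C' + 1)%N; pose K := (k1 + k2 + k3)%N.
have D0 : (0 < D%:R :> R)%R by rewrite ltr0n /D addn1.
exists D%:R%R, K%:R%R; split=> [||x x'|y].
- by rewrite ler1n /D addn1.
- by rewrite ler0n.
- rewrite /word_dist; apply/andP; split.
    rewrite lerBlDr ler_pdivrMl // -natrD -natrM ler_nat.
    have -> : x^-1 * x' = (x^-1 * f' (f x)) * ((f' (f x))^-1 * f' (f x')) *
        ((f' (f x'))^-1 * x').
      by rewrite !mulgA !mulgK.
    apply: leq_trans (word_lengthM Sgen _ _) _.
    apply: leq_trans (leq_add (word_lengthM Sgen _ _) (kf'f x')) _.
    apply: leq_trans (leq_add (leq_add (kf'f' x) (f'C _ _)) (leqnn _)) _.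
    rewrite /D /K; nia.
  rewrite -natrM -natrD ler_nat; apply: leq_trans (fC _ _) _.
  by rewrite /D; nia.
- by exists (f' y); rewrite /word_dist ler_nat; 
  apply: leq_trans (kff' y) _; rewrite leq_addl.
Qed.

(** [f'] picks coarse preimages. By the lower bound [f] reflects closeness, so the coarseness of
    [f'] and the closeness of [f' \o f] to the identity are checked after composing with [f]. *)
Lemma qi_coarse_equivalence (f : G -> H) :
  quasi_isometry (word_dist R S) (word_dist R T) f -> exists f' : H -> G,
  [/\ coarse_map f, coarse_map f', near (f' \o f) id & near (f \o f') id].
Proof.
move=> [C [K [C1 K0 fCK fsurj]]].
have C0 : (0 < C)%R by apply: lt_le_trans C1.
have fn I (u v : I -> G) : near u v -> near (f \o u) (f \o v).
  move=> /(near_word_dist R Sgen)[r uv].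
  apply: (word_dist_near (r := (C * r + K)%R) Tgen) => t /=.
  have /andP[_] := fCK (u t) (v t); move=> /le_trans; apply.
  by rewrite lerD2r ler_wpM2l ?(ltW C0) ?uv.
have fnV I (u v : I -> G) : near (f \o u) (f \o v) -> near u v.
  move=> /(near_word_dist R Tgen)[r uv].
  apply: (word_dist_near (r := (C * (r + K))%R) Sgen) => t /=.
  have /andP[+ _] := fCK (u t) (v t); rewrite lerBlDr ler_pdivrMl // => /le_trans; apply.
  by rewrite ler_wpM2l ?(ltW C0) ?lerD2r ?uv.
have /choice[f' f'P] := fsurj.
have ff' : near (f \o f') id by apply: (word_dist_near (r := K) Tgen) => t /=.
exists f'; split=> //.
- by move=> e; apply: fn (close_act _ e).
- move=> e; apply: fnV.
  apply: (close_trans ff'); apply: (close_trans (close_act _ e)).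
  exact: (close_comp (rmul_action H e) (close_sym ff')).
- by apply: fnV; apply: (close_comp f ff').
Qed.

End QuasiIsometry.

(** * Quasi-isometries of pairs on coset spaces *)

(** The distance is an infimum, so a radius realizing both inclusions is only found strictly above
    [Q]; the slack 1 is arbitrary. *)
Lemma hausdorff_dist_le (R : realType) (X : Type) (d : X -> X -> R)
    (A B : set X) (Q : R) : (hausdorff_dist d A B <= Q%:E)%E ->
  A `<=` nbhd d (Q + 1)%R B /\ B `<=` nbhd d (Q + 1)%R A.
Proof.
move=> dAB; have : (hausdorff_dist d A B < (Q + 1)%:E)%E.
  by apply: le_lt_trans dAB _; rewrite lte_fin ltrDl.
move=> /ereal_inf_lt[_ [r [_ AB BA] <-]]; rewrite lte_fin => rQ.
by split=> x; [move=> /AB|move=> /BA]; move=> -[a ? xa]; exists a => //;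
  apply: le_trans xa (ltW rQ).
Qed.

Section Coset.
Variables (G : groupType) (M : set G).
Implicit Types (g k : G) (x : cosets M).

Let coset_subproof g : left_coset M g \in range (left_coset M).
Proof. by apply/mem_set; exists g. Qed.

Definition left_coset_of g : cosets M := SigSub (coset_subproof g).

Lemma left_coset_ofP x : exists g, x = left_coset_of g.
Proof.
by have /set_mem[g _ gx] := valP x; exists g; apply: val_inj; rewrite /= gx.
Qed.

Definition coset_repr x : G := sval (cid (left_coset_ofP x)).

Lemma coset_reprK : cancel coset_repr left_coset_of.
Proof. by move=> x; rewrite /coset_repr; case: cid. Qed.

Lemma left_mul_coset_of g k :
  left_mul_coset g (left_coset_of k) = left_coset_of (g * k).
Proof.
apply: val_inj; apply/seteqP; split=> [_ [_ [m Mm <-] <-]|_ [m Mm <-]] /=.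
  by exists m; rewrite ?mulgA.
by exists (k * m); rewrite ?mulgA //; exists m.
Qed.

Hypothesis nM : normal_subgroup M.

Let M1 : M 1. Proof. by case: nM => -[/set_mem]. Qed.

Let MD m m' : M m -> M m' -> M (m * m'^-1).
Proof. by case: nM => -[_ MM] _ /mem_set Mm /mem_set Mm'; apply/set_mem/MM. Qed.

Lemma normal_subgroupV m : M m -> M m^-1.
Proof. by move=> /(MD M1); rewrite mul1g. Qed.

Lemma normal_subgroupM m m' : M m -> M m' -> M (m * m').
Proof. by move=> Mm /normal_subgroupV/(MD Mm); rewrite invgK. Qed.

Lemma normal_subgroupJ g m : M m -> M (g * m * g^-1).
Proof.
by case: nM => _ MJ /(MJ g^-1); rewrite /conjg invgK mulgA.
Qed.

Lemma left_coset_of_eq g k :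
  left_coset_of g = left_coset_of k <-> exists2 m, M m & k = g * m.
Proof.
split=> [/(congr1 val)/= gk|[m Mm ->]].
  have : left_coset M k k by exists 1; rewrite ?mulg1.
  by rewrite -gk => -[m Mm <-]; exists m.
apply: val_inj; apply/seteqP; split=> [_ [m' Mm' <-]|_ [m' Mm' <-]] /=.
  exists (m^-1 * m'); last by rewrite mulgA mulgK.
  exact/normal_subgroupM/Mm'/normal_subgroupV.
by exists (m * m'); rewrite ?mulgA //; exact: normal_subgroupM.
Qed.

Lemma left_coset_ofMr m g : M m -> left_coset_of (g * m) = left_coset_of g.
Proof. by move=> Mm; apply/esym/left_coset_of_eq; exists m. Qed.

(** By normality [m * e] is [e] times a conjugate of [m], so right multiplication descends to left
    cosets. *)
Lemma left_coset_of_mul g k e : left_coset_of g = left_coset_of k ->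
  left_coset_of (g * e) = left_coset_of (k * e).
Proof.
move=> /left_coset_of_eq[m Mm ->]; apply/left_coset_of_eq.
exists (e^-1 * m * e); last by rewrite !mulgA mulgK.
by rewrite -[X in _ * _ * X]invgK; apply: normal_subgroupJ.
Qed.

Let rmul (e : G) x := left_coset_of (coset_repr x * e^-1).

Let rmulE e g : rmul e (left_coset_of g) = left_coset_of (g * e^-1).
Proof. by apply: left_coset_of_mul; rewrite coset_reprK. Qed.

Let rmul1 x : rmul 1 x = x.
Proof. by rewrite -[x in LHS]coset_reprK rmulE invg1 mulg1 coset_reprK. Qed.

Let rmulM e e' x : rmul (e * e') x = rmul e (rmul e' x).
Proof. by rewrite -[x]coset_reprK !rmulE invMg mulgA. Qed.

(** This action measures displacement on cosets; the lamps of the wreath product are permuted by the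
    left multiplication [coset_action] instead. *)
Definition coset_rmul_action : group_action G (cosets M) :=
  GroupAction rmul1 rmulM.

Lemma coset_rmulE e g :
  coset_rmul_action e (left_coset_of g) = left_coset_of (g * e^-1).
Proof. exact: rmulE. Qed.

Lemma near_coset (T : Type) (u v : T -> G) : near u v ->
  close coset_rmul_action (left_coset_of \o u) (left_coset_of \o v).
Proof.
by move=> [E uv]; exists E => t; have [e Ee /= ->] := uv t; exists e;
  rewrite ?coset_rmulE.
Qed.

End Coset.

Arguments left_coset_of {G} M g.

Section CosetMap.
Variables (G H : groupType) (M : set G) (N : set H).
Hypotheses (nM : normal_subgroup M) (nN : normal_subgroup N).
Local Notation aM := (coset_rmul_action nM).
Local Notation aN := (coset_rmul_action nN).

Definition coset_map (f : G -> H) (c : cosets M) : cosets N :=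
  left_coset_of N (f (coset_repr c)).

(** Well-definedness on cosets up to bounded displacement. Families over an arbitrary [T] make the
    bound uniform over all pairs of points in a common coset. *)
Definition coset_compatible (f : G -> H) : Prop := forall (T : Type) (u v : T -> G),
  left_coset_of M \o u =1 left_coset_of M \o v ->
  close aN (left_coset_of N \o f \o u) (left_coset_of N \o f \o v).

Variable f : G -> H.
Hypotheses (fc : coarse_map f) (fMN : coset_compatible f).

Lemma coset_map_close :
  close aN (coset_map f \o left_coset_of M) (left_coset_of N \o f).
Proof.
by apply: (fMN (u := @coset_repr _ _ \o left_coset_of M) (v := id)) => g /=;
  rewrite coset_reprK.
Qed.

Lemma coset_map_coarse : coarse aM aN (coset_map f).
Proof.
move=> e.
apply: (close_trans (v := left_coset_of N \o f \o (rmul_action G e \o @coset_repr _ M))).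
  exact: (near_coset nN (close_comp (@coset_repr _ M) (fc e))).
apply: (fMN (v := @coset_repr _ M \o aM e)) => c /=.
by rewrite coset_reprK -coset_rmulE coset_reprK.
Qed.

End CosetMap.

Arguments coset_map {G H} M N f c.

Lemma coset_map_cancel (G H : groupType) (M : set G) (N : set H)
    (nM : normal_subgroup M) (nN : normal_subgroup N) (f : G -> H) (k : H -> G) :
  coarse_map k -> coset_compatible M nN f -> coset_compatible N nM k ->
  near (k \o f) id ->
  close (coset_rmul_action nM) (coset_map N M k \o coset_map M N f) id.
Proof.
move=> kc fMN kNM kf.
apply: (close_trans (v := left_coset_of M \o k \o f \o @coset_repr _ M)).
  exact: (close_comp (f \o @coset_repr _ M) (coset_map_close kNM)).
have := close_comp (@coset_repr _ M) (near_coset nM kf).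
by congr close; apply/funext => c /=; rewrite coset_reprK.
Qed.

Section Pairs.
Variables (R : realType) (G H : groupType) (S : {fset G}) (T : {fset H}).
Variables (M : set G) (N : set H).
Hypotheses (Sgen : generates S) (Tgen : generates T).
Hypotheses (nM : normal_subgroup M) (nN : normal_subgroup N).

(** To each [g] is attached a coset, that of [k g], at Hausdorff distance at most [Q] from the image
    of the coset of [g]. For [f], points of one coset are thus sent near one coset; for [f'], the
    other inclusion of the Hausdorff bound is pulled back. *)
Lemma pairs_coset_compatible (f : G -> H) :
  quasi_isometry_of_pairs (word_dist R S) M (word_dist R T) N f ->
  exists f' : H -> G,
  [/\ coarse_map f, coarse_map f', near (f' \o f) id & near (f \o f') id] /\
  coset_compatible M nN f /\ coset_compatible N nM f'.
Proof.
move=> [fqi [Q Q0 [fQ _]]].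
have [f' [fc f'c f'f ff']] := qi_coarse_equivalence Sgen Tgen fqi.
exists f'; split=> //.
have /choice[k kP] g : exists h,
    (forall g', left_coset_of M g = left_coset_of M g' ->
       exists2 h', left_coset_of N h = left_coset_of N h' &
                   (word_dist R T (f g') h' <= Q + 1)%R) /\
    (forall h', left_coset_of N h = left_coset_of N h' ->
       exists2 g', left_coset_of M g = left_coset_of M g' &
                   (word_dist R T h' (f g') <= Q + 1)%R).
  have [h /hausdorff_dist_le[fg hf]] := fQ g; exists h; split.
    move=> _ /(left_coset_of_eq nM)[m Mm ->].
    have [|_ [n Nn <-] hQ] := fg (f (g * m)); first by exists (g * m); [exists m|].
    by exists (h * n); rewrite ?left_coset_ofMr.
  move=> _ /(left_coset_of_eq nN)[n Nn ->].
  have [|_ [_ [m Mm <-] <-] hQ] := hf (h * n); first by exists n.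
  by exists (g * m); rewrite ?left_coset_ofMr.
have fk I (u v : I -> G) : left_coset_of M \o u =1 left_coset_of M \o v ->
    close (coset_rmul_action nN) (left_coset_of N \o k \o u) (left_coset_of N \o f \o v).
  move=> uv; have /choice[h hP] i : exists h',
      left_coset_of N (k (u i)) = left_coset_of N h' /\
      (word_dist R T (f (v i)) h' <= Q + 1)%R.
    by have [+ _] := kP (u i) => /(_ _ (uv i))[h' ? ?]; exists h'.
  have -> : left_coset_of N \o k \o u = left_coset_of N \o h.
    by apply/funext => i; have [] := hP i.
  apply/near_coset/close_sym.
  by apply: (word_dist_near (r := (Q + 1)%R) Tgen) => i; have [] := hP i.
split=> I u v uv.
  by apply: (close_trans (close_sym (fk _ u u _))) => //; exact: fk.
have kff' : close (coset_rmul_action nN)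
    (left_coset_of N \o k \o f' \o u) (left_coset_of N \o u).
  apply: (close_trans (fk _ (f' \o u) (f' \o u) _)) => //.
  exact: (near_coset nN (close_comp u ff')).
have [E kE] := close_sym kff'.
have /choice[e eP] i : exists e, e \in E /\
    left_coset_of N (k (f' (u i))) = coset_rmul_action nN e (left_coset_of N (u i)).
  by have [e ? ?] := kE i; exists e.
(* [e i] shifts [v i] into the coset of [k (f' (u i))], whose points are near images of points of
   the coset of [f' (u i)]. Then [f' (v i)] will be near [g i]. *)
have /choice[g gP] i : exists g, left_coset_of M (f' (u i)) = left_coset_of M g /\
    (word_dist R T (v i * (e i)^-1) (f g) <= Q + 1)%R.
  have [_ /(_ (v i * (e i)^-1))[|g ? ?]] := kP (f' (u i)); last by exists g.
  by have [_ ->] := eP i; rewrite -coset_rmulE [left_coset_of N (u i)]uv.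
have -> : left_coset_of M \o f' \o u = left_coset_of M \o g.
  by apply/funext => i; have [] := gP i.
apply: near_coset; apply: close_sym.
have vg : near v (f \o g).
  apply: (close_trans (v := fun i => v i * (e i)^-1)).
    by exists E => i; exists (e i); have [] := eP i.
  by apply: (word_dist_near (r := (Q + 1)%R) Tgen) => i; have [] := gP i.
apply: (close_trans (coarse_close f'c vg)); exact: (close_comp g f'f).
Qed.

End Pairs.

(** * Expansion from non-co-amenability *)

Section UltraLimit.
Local Open Scope ring_scope.

(** Limit along an ultrafilter refining [\oo]: bounded sequences converge by compactness of
    segments. The last clause is what yields invariance of the mean. *)
Lemma positive_limit (R : realType) : exists L : (nat -> R) -> R,
  [/\ (forall (t : R) u v, bounded_function u -> bounded_function v ->
        L (fun k => t * u k + v k) = t * L u + L v),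
      (forall u, bounded_function u -> (forall k, 0 <= u k) -> 0 <= L u),
      L (fun=> 1) = 1 &
      (forall u (C : R), (forall k, `|u k| <= C / k.+1%:R) -> L u = 0)].
Proof.
have [U [Uultra ooU]] := ultraFilterLemma (@eventually_filter).
have bnd_cvg (u : nat -> R) : bounded_function u -> exists l : R, u @ U --> l.
  move=> [C uC]; have : (u @ U) `[- C, C]%classic.
    by apply: (@filterE _ U) => k; rewrite /= in_itv /= -ler_norml.
  (* Compactness gives a cluster point; for an ultrafilter a cluster point is a limit. *)
  move=> /(@segment_compact R (- C) C _ _)[l [_ lU]]; exists l.
  move=> A Al; have [//|nA] := in_ultra_setVsetC (u @^-1` A) Uultra.
  by have [x [nAx Ax]] := lU (~` A) A nA Al.
have bndL (u : nat -> R) : bounded_function u -> u @ U --> lim (u @ U).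
  by move=> /bnd_cvg[l ul]; apply/cvg_ex; exists l.
exists (fun u => lim (u @ U)); split.
- move=> t u v /bndL ul /bndL vl; apply/cvg_lim => //.
  by apply: cvgD vl; apply: cvgM ul; exact: cvg_cst.
- move=> u /bndL ul u0.
  by apply: limr_ge; [apply/cvg_ex; eexists; exact: ul|exact: nearW].
- by apply/cvg_lim => //; exact: cvg_cst.
- move=> u C uC; apply/cvg_lim => //.
  suff: u @ \oo --> (0 : R) by move=> u0 A /u0 uA; apply: ooU.
  apply: norm_cvg0.
  have ub : (fun k => C / k.+1%:R) @ \oo --> (0 : R).
    rewrite -[X in _ --> X](mulr0 C); apply: cvgM cvg_harmonic; exact: cvg_cst.
  apply: squeeze_cvgr (cvg_cst _) ub.
  by apply: nearW => k; rewrite normr_ge0 uC.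
Qed.

End UltraLimit.

Section Thicken.
Variables (G : groupType) (X : choiceType) (a : group_action G X).
Implicit Types (E : seq G) (A : {fset X}).

Definition thicken E A : {fset X} :=
  (\bigcup_(x <- A) [fset a e x | e in E])%fset.

Lemma thickenP E A y :
  reflect (exists e x, [/\ e \in E, x \in A & y = a e x]) (y \in thicken E A).
Proof.
apply: (iffP (bigfcupP _ _ _ _)) => [[x /andP[Ax _] /imfsetP[e /= Ee ->]]|].
  by exists e, x.
by move=> [e [x [Ee Ax ->]]]; exists x; rewrite ?Ax //; apply/imfsetP; exists e.
Qed.

Lemma thicken_comp E E' A :
  thicken [seq e' * e | e' <- E', e <- E] A = thicken E' (thicken E A).
Proof.
apply/fsetP => y; apply/thickenP/thickenP.
  move=> [_ [x [/allpairsP[[e' e]/= [E'e' Ee ->]] Ax ->]]].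
  by exists e', (a e x); rewrite gactM; split=> //; apply/thickenP; exists e, x.
move=> [e' [_ [E'e' /thickenP[e [x [Ee Ax ->]]] ->]]].
by exists (e' * e), x; rewrite gactM; split=> //; apply: allpairs_f.
Qed.

(** Iterating [k] times multiplies the growth factor [q.+2 / q.+1] into its [k]-th power, which is
    unbounded. *)
Lemma thicken_expand E q : (forall A, q.+2 * #|` A| <= q.+1 * #|` thicken E A|) ->
  forall K, exists E', forall A, K * #|` A| <= #|` thicken E' A|.
Proof.
move=> qE K.
have iterE k : exists E', forall A, q.+2 ^ k * #|` A| <= q.+1 ^ k * #|` thicken E' A|.
  elim: k => [|k [E' IH]].
    exists [:: 1] => A; rewrite !mul1n; apply: fsubset_leq_card.
    by apply/fsubsetP => x Ax; apply/thickenP; exists 1, x; rewrite gact1 inE.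
  exists [seq e' * e | e' <- E', e <- E] => A; rewrite thicken_comp.
  have := leq_mul (leqnn (q.+2 ^ k)) (qE A).
  have := leq_mul (leqnn q.+1) (IH (thicken E A)).
  rewrite !expnS; nia.
(* Bernoulli's inequality for [1 + 1 / q.+1], cleared of denominators; the exponent [q.+1 * K] then
   gives a factor of at least [K.+1]. *)
have bernoulli k : q.+1 ^ k * (q.+1 + k) <= q.+2 ^ k * q.+1.
  by elim: k => [|k IH]; rewrite ?mul1n ?addn0 // !expnS; nia.
have [E' E'P] := iterE (q.+1 * K)%N; exists E' => A.
have q0 : (0 < q.+1 ^ (q.+1 * K))%N by rewrite expn_gt0.
have := bernoulli (q.+1 * K)%N; have := E'P A.
move: (q.+2 ^ _)%N (q.+1 ^ _)%N q0 => x y y0 xy yx.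
rewrite -(leq_pmul2l y0); apply: leq_trans xy; rewrite mulnA leq_mul2r.
by apply/orP; right; nia.
Qed.

End Thicken.

(** Common terms cancel, and equal sizes force as many elements in [A] outside [B] as in [B] outside
    [A]. *)
Lemma sum_diff_le (R : realType) (X : eqType) (A B : seq X) (g : X -> R) (C : R) :
  uniq A -> uniq B -> size A = size B -> (forall x, `|g x| <= C)%R ->
  (`|\sum_(x <- B) g x - \sum_(x <- A) g x| <=
     C * (2 * count [predC A] B)%:R)%R.
Proof.
move=> uA uB sAB gC.
rewrite (bigID [in A]) [X in (_ - X)%R](bigID [in B]) /=.
have -> : (\sum_(x <- A | x \in B) g x = \sum_(x <- B | x \in A) g x)%R.
  rewrite -big_filter -[RHS]big_filter; apply: perm_big.
  by apply: uniq_perm; rewrite ?filter_uniq // => x; rewrite !mem_filter andbC.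
have -> (x y z : R) : (x + y - (x + z) = y - z)%R by rewrite opprD addrACA subrr add0r.
have bnd (P : pred X) s : (`|\sum_(x <- s | P x) g x| <= C * (count P s)%:R)%R.
  apply: le_trans (ler_norm_sum _ _ _) _.
  apply: le_trans (ler_sum _ (fun x _ => gC x)) _.
  by rewrite big_const_seq iter_addr addr0 mulr_natr.
apply: le_trans (ler_normB _ _) _; apply: le_trans (lerD (bnd _ _) (bnd _ _)) _.
rewrite -mulrDr -natrD (_ : count (fun x => x \notin B) A = count [predC A] B).
  by rewrite mul2n -addnn.
have := count_predC [in A] B; have := count_predC [in B] A; rewrite sAB => <-.
have -> : count [in A] B = count [in B] A.
  rewrite -!size_filter; apply: perm_size.
  by apply: uniq_perm; rewrite ?filter_uniq // => x; rewrite !mem_filter andbC.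
by move=> /addnI.
Qed.

Section Folner.
Variables (R : realType) (G : groupType) (M : set G) (S : {fset G}).
Hypotheses (nM : normal_subgroup M) (Sgen : generates S).
Local Notation X := (cosets M).
Local Notation aM := (coset_rmul_action nM).

Let invc (x : X) : X := left_coset_of M (coset_repr x)^-1.

Let invcE g : invc (left_coset_of M g) = left_coset_of M g^-1.
Proof.
have /(left_coset_of_eq nM)[m Mm mE] := coset_reprK (left_coset_of M g).
rewrite /invc {2}mE invMg; apply/(left_coset_of_eq nM).
exists (coset_repr (left_coset_of M g) * m^-1 * (coset_repr (left_coset_of M g))^-1).
  by apply: normal_subgroupJ; [exact: nM|apply: normal_subgroupV].
by rewrite !mulgA mulVg mul1g.
Qed.

Let left_mul_invc h x : left_mul_coset h (invc x) = invc (aM h x).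
Proof.
by rewrite -[x]coset_reprK coset_rmulE !invcE left_mul_coset_of invMg invgK.
Qed.

(* Inversion turns sets almost invariant under right multiplication into sets
   almost invariant under left multiplication. *)
Lemma folner_co_amenable :
  (forall q, exists A : {fset X},
     q.+1 * #|` thicken aM (1 :: S) A| < q.+2 * #|` A|) ->
  co_amenable R M.
Proof.
move=> /choice[A AP].
have A0 q : (0 < #|` A q|%:R :> R)%R.
  by rewrite ltr0n; have := AP q; case: #|` A q| => //; rewrite muln0.
have [L [Llin Lpos L1 L0]] := positive_limit R.
pose avg (f : X -> R) q := ((\sum_(x <- A q) f (invc x)) / #|` A q|%:R)%R.
have avg_bnd f : bounded_function f -> bounded_function (avg f).
  move=> [C fC]; exists C => q; rewrite normrM normfV [X in (_ / X)%R]ger0_norm ?ler0n //.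
  rewrite ler_pdivrMr //; apply: le_trans (ler_norm_sum _ _ _) _.
  apply: le_trans (ler_sum _ (fun x _ => fC (invc x))) _.
  by rewrite big_const_seq iter_addr addr0 count_predT mulr_natr.
exists (fun f => L (avg f)).
have linL (t : R) f g : bounded_function f -> bounded_function g ->
    (L (avg (fun x => t * f x + g x)%R) = t * L (avg f) + L (avg g))%R.
  move=> /avg_bnd fb /avg_bnd gb; rewrite -Llin //; congr L; apply/funext => q.
  by rewrite /avg big_split /= -mulr_sumr mulrDl mulrA.
split=> //.
- move=> f /avg_bnd fb f0; apply: Lpos => // q.
  by rewrite divr_ge0 ?ler0n // sumr_ge0.
- rewrite -[RHS]L1; congr L; apply/funext => q.
  by rewrite /avg big_const_seq iter_addr addr0 count_predT divff // gt_eqF.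
(* Invariance passes to products and inverses, so generators suffice. *)
pose inv h := forall f : X -> R, bounded_function f ->
  L (avg (fun x => f (left_mul_coset h x))) = L (avg f).
have bndM h (f : X -> R) : bounded_function f ->
    bounded_function (fun x : X => f (left_mul_coset h x)).
  by move=> [C fC]; exists C.
have invM h k : inv h -> inv k -> inv (h * k).
  move=> ih ik f fb; rewrite -(ih f fb) -(ik _ (bndM h _ fb)).
  by congr L; congr avg; apply/funext => x; rewrite left_mul_cosetM.
have invV h : inv h -> inv h^-1.
  move=> ih f fb; rewrite -(ih _ (bndM h^-1 _ fb)); congr L; congr avg.
  by apply/funext => x; rewrite -left_mul_cosetM mulVg left_mul_coset1.
have inv1 : inv 1.
  by move=> f fb; congr L; congr avg; apply/funext => x; rewrite left_mul_coset1.
suff invS s : s \in S -> inv s.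
  move=> h; have [w [wS <-]] := Sgen h; elim: w wS => [|s w IH] /= wS.
    by rewrite big_nil; exact: inv1.
  case/andP: wS => sS /IH wS; rewrite big_cons; apply: invM wS.
  by case/orP: sS => /invS // /invV; rewrite invgK.
move=> sS f fb; have [C fC] := fb.
have fsb := bndM s _ fb.
(* Put in the shape of the linearity clause of [L]; it remains to show that the difference of the
   averages has limit 0. *)
have diff : avg (fun x => f (left_mul_coset s x)) =
    (fun q => 1 * (avg (fun x => f (left_mul_coset s x)) q + (- 1) * avg f q) +
       avg f q)%R.
  by apply/funext => q; rewrite mul1r mulN1r subrK.
rewrite diff Llin; [|  |exact: avg_bnd]; last first.
  have [C1 C1P] := avg_bnd _ fb; have [C2 C2P] := avg_bnd _ fsb.
  exists (C2 + C1)%R => q; rewrite mulN1r; apply: le_trans (ler_normB _ _) _.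
  exact: lerD.
(* The thickening contains [A q] because of the entry 1, so the translate by [s] has fewer than a
   fraction [1 / q.+1] of its points outside [A q]; each costs at most [2 * C]. *)
rewrite mul1r (L0 _ (C * 2)%R) ?add0r // => q.
rewrite mulN1r -mulrBl normrM normfV [X in (_ / X)%R]ger0_norm ?ler0n //.
rewrite ler_pdivrMr //.
have C0 : (0 <= C)%R by apply: le_trans (normr_ge0 _) (fC (left_coset_of M 1)).
under eq_bigr do rewrite left_mul_invc.
rewrite -(big_map (aM s) xpredT (fun y => f (invc y))) /=.
have uB : uniq [seq aM s x | x <- A q].
  by rewrite map_inj_uniq ?fset_uniq //; exact: (can_inj (gactK aM s)).
apply: le_trans (sum_diff_le _ _ _ (fun x => fC (invc x))) _ => //.
- by rewrite size_map.
set c := count _ _; rewrite natrM mulrA -[leRHS]mulrA.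
rewrite ler_wpM2l ?mulr_ge0 // ler_pdivlMl ?ltr0n // -natrM ler_nat.
have : c + #|` A q| <= #|` thicken aM (1 :: S) (A q)|.
  rewrite /c -size_filter -size_cat; apply: uniq_leq_size.
    rewrite cat_uniq filter_uniq // fset_uniq andbT /=; apply/hasPn => x Ax.
    by rewrite mem_filter /= negb_and negbK Ax.
  move=> x; rewrite mem_cat mem_filter => /orP[/andP[_ /mapP[y Ay ->]]|Ax].
    by apply/thickenP; exists s, y; rewrite inE sS orbT.
  by apply/thickenP; exists 1, x; rewrite gact1 inE eqxx.
have := AP q; clearbody c; move: #|` thicken _ _ _| #|` A q| => t k; nia.
Qed.

(** Without almost invariant sets, one factor [q.+2 / q.+1] of growth is valid for all finite sets,
    and [thicken_expand] amplifies it. *)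
Lemma co_amenable_expand : ~ co_amenable R M ->
  forall K, exists E, forall A : {fset X}, K * #|` A| <= #|` thicken aM E A|.
Proof.
move=> nam; suff [q qP] : exists q, forall A : {fset X},
    q.+2 * #|` A| <= q.+1 * #|` thicken aM (1 :: S) A| by apply: thicken_expand qP.
apply: contrapT => nq; apply: nam; apply: folner_co_amenable => q.
apply: contrapT => nA; apply: nq; exists q => A.
by rewrite leqNgt; apply/negP => qA; apply: nA; exists A.
Qed.

End Folner.

(** * Local bijections *)

(** Hall's theorem for [X * I], all copies of [x] sharing the candidates [F x]: a finite set of
    copies is at most [#|I|] times larger than its projection. *)
Lemma hall_marriage_multi (X Y : choiceType) (I : finType) (F : X -> {fset Y}) :
  (forall A : {fset X}, #|I| * #|` A| <= #|` \bigcup_(x <- A) F x|) ->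
  exists2 t : X * I -> Y, injective t & forall z, t z \in F z.1.
Proof.
move=> hF; apply: (@hall_marriage _ _ (F \o fst)) => A.
pose P := [fset z.1 | z in A]%fset.
have -> : (\bigcup_(z <- A) (F \o fst) z = \bigcup_(x <- P) F x)%fset.
  apply/fsetP => y; apply/bigfcupP/bigfcupP => [[z /andP[Az _] Fy]|[x]].
    by exists z.1; rewrite // andbT; apply/imfsetP; exists z.
  by move=> /andP[/imfsetP[z /= Az ->] _] Fy; exists z; rewrite ?Az.
apply: leq_trans (hF P); rewrite mulnC cardE -(size_allpairs pair P (enum I)).
apply: uniq_leq_size => [|[x i] Axi]; first exact: fset_uniq.
by apply: (allpairs_f pair); rewrite ?mem_enum //; apply/imfsetP; exists (x, i).
Qed.

Lemma card_thicken (G : groupType) (X : choiceType) (a : group_action G X)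
    (E : seq G) (A : {fset X}) : #|` thicken a E A| <= size E * #|` A|.
Proof.
rewrite -(size_allpairs (fun e x => a e x) E A).
apply: uniq_leq_size => [|y /thickenP[e [x [Ee Ax ->]]]]; first exact: fset_uniq.
exact: (allpairs_f (fun e x => a e x)).
Qed.

(** Two points with equal images are uniformly close, both being close to their common image under
    [g \o f]; hence fibres have bounded size. *)
Lemma coarse_card_fiber (G H : groupType) (X Y : choiceType)
    (a : group_action G X) (b : group_action H Y) (f : X -> Y) (g : Y -> X) :
  coarse b a g -> close a (g \o f) id ->
  exists D, forall A : {fset X}, #|` A| <= D.+1 * #|` [fset f x | x in A]%fset|.
Proof.
move=> gc gf; pose T := {p : X * X | f p.1 = f p.2}.
have [E ET] : close a (fun p : T => (sval p).1) (fun p : T => (sval p).2).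
  apply: (close_trans (close_sym (close_comp (fun p : T => (sval p).1) gf))).
  have := close_comp (fun p : T => (sval p).2) gf; congr close.
  by apply/funext => -[p pE] /=; rewrite pE.
have /choice[r rP] y : exists x0, forall x, f x = y -> exists2 e, e \in E & x = a e x0.
  have [[x0 x0y]|nx] := pselect (exists x0, f x0 = y); last first.
    (* Over an empty fibre any representative will do. *)
    have [x0] : exists x0 : X, True by exists (g y).
    by exists x0 => x xy; case: nx; exists x.
  exists x0 => x xy; have xx : f (x0, x).1 = f (x0, x).2 by rewrite /= x0y xy.
  exact: (ET (exist _ _ xx)).
exists (size E) => A.
apply: (@leq_trans #|` thicken a E [fset r y | y in [fset f x | x in A]]%fset|).
  apply: fsubset_leq_card; apply/fsubsetP => x Ax.
  have [e Ee xE] := rP _ _ (erefl (f x)); apply/thickenP.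
  exists e, (r (f x)); split=> //; apply/imfsetP; exists (f x) => //=.
  by apply/imfsetP; exists x.
apply: leq_trans (card_thicken _ _ _) _; apply: leq_mul (leqnSn _) _.
exact: leq_imfset_card.
Qed.

Section LocalBijection.
Variables (G H : groupType) (X Y : choiceType).
Variables (a : group_action G X) (b : group_action H Y).
Variables (f : X -> Y) (g : Y -> X).
Hypotheses (fc : coarse a b f) (gc : coarse b a g).
Hypotheses (gf : close a (g \o f) id) (fg : close b (f \o g) id).
Hypothesis expand :
  forall K, exists E, forall A : {fset X}, K * #|` A| <= #|` thicken a E A|.

Lemma close_mem (T : Type) (u v : T -> X) (E : seq G) :
  (forall t, v t \in [fset a e (u t) | e in E]%fset) -> close a u v.
Proof. by move=> uv; exists E => t; have /imfsetP[e] := uv t; exists e. Qed.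

(** Since [f] divides cardinals by at most [D.+1], expanding by [D.+1 * #|I|] before applying it
    leaves the factor [#|I|] that Hall's condition needs. *)
Lemma local_injection (I : finType) : exists2 t : X * I -> Y,
  injective t & close b (f \o fst) t.
Proof.
have [D DP] := coarse_card_fiber gc gf.
have [E EP] := expand (D.+1 * #|I|).
have [|t tinj tP] := @hall_marriage_multi X Y I
    (fun x => [fset f y | y in [fset a e x | e in E]]%fset).
  move=> A; rewrite -(leq_pmul2l (ltn0Sn D)) mulnA.
  apply: leq_trans (EP A) _; apply: leq_trans (DP _) _; apply: leq_mul => //.
  apply: fsubset_leq_card; apply/fsubsetP => y /imfsetP[x /= Ex ->].
  have /bigfcupP[x0 Ax0 xE] := Ex; apply/bigfcupP; exists x0 => //.
  by apply/imfsetP; exists x.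
exists t => //; have /choice[u uP] z : exists x,
    x \in [fset a e z.1 | e in E]%fset /\ t z = f x.
  by have /imfsetP[x] := tP z; exists x.
have -> : t = f \o u by apply/funext => z; have [] := uP z.
by apply: (coarse_close fc); apply: (@close_mem _ _ _ E) => z; have [] := uP z.
Qed.

(** Expansion is available in [X], so [g y] is thickened after applying [g], whose fibres are
    bounded as well. *)
Lemma local_injectionV (I : finType) : exists2 t : Y * I -> X,
  injective t & close a (g \o fst) t.
Proof.
have [D DP] := coarse_card_fiber fc fg.
have [E EP] := expand (D.+1 * #|I|).
have [|t tinj tP] := @hall_marriage_multi Y X I
    (fun y => [fset a e (g y) | e in E]%fset).
  move=> A.
  apply: leq_trans (_ : _ <= D.+1 * #|I| * #|` [fset g y | y in A]%fset|) _.
    by rewrite mulnAC mulnC leq_mul2r DP orbT.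
  apply: leq_trans (EP _) _; apply: fsubset_leq_card; apply/fsubsetP => x.
  case/bigfcupP => _ /andP[/imfsetP[y /= Ay ->] _] xE.
  by apply/bigfcupP; exists y; rewrite ?Ay.
by exists t => //; apply: (@close_mem _ _ _ E) => z; apply: tP.
Qed.

Lemma local_bijection (I J : finType) (p : I -> nat) (q : J -> nat)
    (s : I -> J) (t : J -> I) : q \o s =1 p -> p \o t =1 q ->
  exists (h : X * I -> Y * J) (k : Y * J -> X * I),
    [/\ cancel h k, cancel k h, forall z, q (h z).2 = p z.2 &
        close b (f \o fst) (fst \o h)].
Proof.
move=> qs pt.
have [u uinj uP] := local_injection I; have [v vinj vP] := local_injectionV J.
(* Injectivity comes from [u] and [v] alone, so [s] and [t] may merge indices: multiplicities of
   primes can differ on the two sides. *)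
have [h [k [hK kK hP]]] := @cantor_bernstein_pointwise (X * I) (Y * J)
    (fun z => (u z, s z.2)) (fun z => (v z, t z.2))
    (fun _ _ e => uinj _ _ (congr1 fst e)) (fun _ _ e => vinj _ _ (congr1 fst e)).
exists h, k; split=> // [z|].
  by have [->|e] := hP z; [exact: qs | rewrite -(congr1 snd e); exact/esym/pt].
(* Where [h] inverts the map built from [v], [v (h z)] is the first component of [z]; closeness then
   follows from [v] being close to [g] and [f \o g] to the identity. *)
have fv : close b (f \o v \o h) (fst \o h).
  apply: (close_trans (close_sym (coarse_close fc (close_comp h vP)))).
  exact: (close_comp (fst \o h) fg).
have [E1 E1P] := uP; have [E2 E2P] := fv.
exists (E1 ++ E2) => z; have [hz|vz] := hP z.
  by have [e Ee uz] := E1P z; exists e; rewrite ?mem_cat ?Ee //= hz.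
have [e Ee vhz] := E2P z; exists e; first by rewrite mem_cat Ee orbT.
by rewrite vhz -{2}vz.
Qed.

End LocalBijection.

(** * Lamp configurations *)

Section MixedRadix.
Local Open Scope nat_scope.

Lemma prime_factors n : 0 < n -> exists s : seq nat,
  [/\ all prime s, \prod_(p <- s) p = n & forall p, (p \in s) = prime p && (p %| n)].
Proof.
move=> n0; suff [s [sp sn]] : exists s : seq nat, all prime s /\ \prod_(p <- s) p = n.
  exists s; split=> // p; rewrite -sn; apply/idP/andP => [ps|[pp]].
    by split; [exact: (allP sp) | rewrite (big_rem p) //= dvdn_mulr].
  elim: s sp {sn} => [|q s IH] /=; last first.
    move=> /andP[qp sp]; rewrite big_cons Euclid_dvdM // dvdn_prime2 // inE.
    by case/orP => [->//|/(IH sp) ->]; rewrite orbT.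
  by rewrite big_nil dvdn1 => _ /eqP p1; rewrite p1 in pp.
elim/ltn_ind: n n0 => n IH n0; have [n1|n1] := leqP n 1.
  by exists [::]; rewrite big_nil; split=> //; apply/eqP; rewrite eqn_leq n0 n1.
have pn := pdiv_prime n1.
have [||s [sp sn]] := IH (n %/ pdiv n).
- by rewrite ltn_Pdiv ?prime_gt1.
- by rewrite divn_gt0 ?pdiv_gt0 // dvdn_leq // pdiv_dvd.
exists (pdiv n :: s); rewrite /= pn big_cons sn; split=> //.
by rewrite mulnC divnK // pdiv_dvd.
Qed.


(** Mixed radix digits for the bases [s], least significant first. *)
Fixpoint digit (s : seq nat) (k i : nat) : nat :=
  if s is p :: s' then
    if i is i'.+1 then digit s' (k %/ p) i' else k %% p
  else 0.

Fixpoint undigits (s : seq nat) (d : nat -> nat) : nat :=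
  if s is p :: s' then d 0 + p * undigits s' (d \o succn) else 0.

Lemma digit0 s i : digit s 0 i = 0.
Proof. by elim: s i => [|p s IH] [|i] //=; rewrite ?mod0n ?div0n. Qed.

Lemma digit_lt s k i : all (ltn 0) s -> i < size s -> digit s k i < nth 0 s i.
Proof.
elim: s k i => [|p s IH] k [|i] //= /andP[p0 s0]; first by rewrite ltn_mod.
by move=> /(IH (k %/ p)); apply.
Qed.

Lemma digitK s k : k < \prod_(p <- s) p -> undigits s (digit s k) = k.
Proof.
elim: s k => [|p s IH] k /=; first by rewrite big_nil; case: k.
rewrite big_cons => ks; have p0 : 0 < p by case: p ks.
rewrite -[_ \o _]/(digit s (k %/ p)) IH; last by rewrite ltn_divLR // mulnC.
by rewrite addnC mulnC -divn_eq.
Qed.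

Lemma undigits_lt s d : (forall i, i < size s -> d i < nth 0 s i) ->
  undigits s d < \prod_(p <- s) p.
Proof.
elim: s d => [|p s IH] d ds; first by rewrite big_nil.
rewrite big_cons /=; have := ds 0 isT; have := IH (d \o succn) (fun i => ds i.+1).
by rewrite /=; nia.
Qed.

Lemma undigitsK s d i : (forall i, i < size s -> d i < nth 0 s i) ->
  i < size s -> digit s (undigits s d) i = d i.
Proof.
elim: s d i => [|p s IH] d [|i] // ds is_ /=; have /= dp := ds 0 isT.
  by rewrite addnC mulnC modnMDl modn_small.
rewrite addnC mulnC divnMDl; last exact: leq_ltn_trans dp.
by rewrite divn_small // addn0 IH // => j; apply: (ds j.+1).
Qed.

Lemma eq_undigits s d d' : (forall i, i < size s -> d i = d' i) ->
  undigits s d = undigits s d'.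
Proof.
elim: s d d' => [//|p s IH] d d' dd' /=; rewrite dd' //; congr (_ + _ * _).
by apply: IH => i; apply: (dd' i.+1).
Qed.

(* [A] is identified with the product of the sets [{0, .., p i - 1}], the base
   point [1] corresponding to the zero family. *)
Definition coding (A : groupType) (I : finType) (p : I -> nat)
    (enc : A -> I -> nat) (dec : (I -> nat) -> A) : Prop :=
  [/\ cancel enc dec, forall x i, enc x i < p i,
      forall d, (forall i, d i < p i) -> enc (dec d) =1 d & forall i, enc 1%g i = 0].

Lemma Zp_coding n (s : seq nat) : 1 < n -> all prime s -> \prod_(p <- s) p = n ->
  exists enc dec, @coding 'Z_n 'I_(size s) (fun i => nth 0 s i) enc dec.
Proof.
move=> n1 sp sn; have s0 : all (ltn 0) s by apply: sub_all sp => p /prime_gt0.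
(* ['Z_n] is by definition the ordinals below [(Zp_trunc n).+2], which is [n] only for [1 < n]. *)
have Zn : (Zp_trunc n).+2 = n by rewrite Zp_cast.
pose ext (d : 'I_(size s) -> nat) i := if insub i is Some j then d j else 0.
have extE d (i : 'I_(size s)) : ext d i = d i by rewrite /ext valK.
have ext_lt (d : 'I_(size s) -> nat) :
      (forall i : 'I_(size s), d i < nth 0 s i) ->
      forall i, i < size s -> ext d i < nth 0 s i.
  by move=> ds i si; rewrite -[i]/(val (Ordinal si)) extE.
exists (fun (x : 'Z_n) (i : 'I_(size s)) => digit s x i),
  (fun d => inZp (undigits s (ext d))).
split=> [x|x i|d ds i|i].
- apply: val_inj; rewrite /= (@eq_undigits _ _ (digit s x)); last first.
    by move=> i si; rewrite -[i]/(val (Ordinal si)) extE.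
  rewrite digitK; first by rewrite modn_small.
  by rewrite sn -[X in _ < X]Zn.
- exact: digit_lt.
- rewrite /= modn_small; first by rewrite undigitsK ?extE //; exact: ext_lt.
  by rewrite Zn -sn; apply/undigits_lt/ext_lt.
- by rewrite digit0.
Qed.

End MixedRadix.

Section Transport.
Variables (A B : groupType) (I J : finType) (p : I -> nat) (q : J -> nat).
Variables (X Y : choiceType) (h : X * I -> Y * J) (k : Y * J -> X * I).
Variables (encA : A -> I -> nat) (decA : (I -> nat) -> A).
Variables (encB : B -> J -> nat) (decB : (J -> nat) -> B).

(** The code of index [j] at [y] is read at [k (y, j)], so a target lamp may combine codes of
    several source lamps. *)
Definition transport (c : {fsfun X -> A with 1}) : {fsfun Y -> B with 1} :=
  [fsfun y in [fset y in [seq (h (x, i)).1 | x <- finsupp c, i <- enum I]]%fset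
     => decB (fun j => encA (c (k (y, j)).1) (k (y, j)).2)].

Hypotheses (codA : coding p encA decA) (codB : coding q encB decB).
Hypotheses (hK : cancel h k) (kK : cancel k h) (hp : forall z, q (h z).2 = p z.2).

(** Outside the declared support every code at [y] is read from a lamp in state 1, hence is zero,
    and the zero family decodes to 1. *)
Lemma transportE c y :
  transport c y = decB (fun j => encA (c (k (y, j)).1) (k (y, j)).2).
Proof.
rewrite fsfunE; case: ifPn => // ny.
have [_ _ _ encA1] := codA; have [encBK _ _ encB1] := codB.
rewrite -[LHS]encBK; congr decB; apply/funext => j; rewrite encB1.
case: (finsuppP c (k (y, j)).1) => [_|cy]; first by rewrite encA1.
case/negP: ny; rewrite !inE; apply/allpairsP; exists (k (y, j)).
by rewrite mem_enum -surjective_pairing kK.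
Qed.

Lemma transport_neq c c' y : transport c y != transport c' y ->
  exists j, c (k (y, j)).1 != c' (k (y, j)).1.
Proof.
move=> neq; apply: contrapT => /forallNP eqc; case/eqP: neq; rewrite !transportE.
by congr decB; apply/funext => j; have /negP/negPn/eqP -> := eqc j.
Qed.

(** Encoding undoes decoding only on families bounded by [q]; [hp] transfers the bound [p] to
    them. *)
Lemma encB_transport c z : encB (transport c (h z).1) (h z).2 = encA (c z.1) z.2.
Proof.
have [_ encA_lt _ _] := codA; have [_ _ decBK _] := codB.
rewrite transportE decBK -?surjective_pairing ?hK // => j.
by have := hp (k ((h z).1, j)); rewrite kK /= => ->.
Qed.

End Transport.

Lemma transportK (A B : groupType) (I J : finType) (p : I -> nat) (q : J -> nat)
    (X Y : choiceType) (h : X * I -> Y * J) (k : Y * J -> X * I)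
    encA decA encB decB :
  @coding A I p encA decA -> @coding B J q encB decB ->
  cancel h k -> cancel k h -> (forall z, q (h z).2 = p z.2) ->
  cancel (transport h k encA decB) (transport k h encB decA).
Proof.
move=> codA codB hK kK hp c; apply/fsfunP => x.
rewrite (transportE codB codA hK); have [encAK _ _ _] := codA.
rewrite -[RHS]encAK; congr decA; apply/funext => i.
by rewrite (encB_transport codA codB hK kK hp).
Qed.

(** Supplies the finite lists of quotients for [wreath_map_coarse]; lamps are peeled off one
    position of [P] at a time. *)
Lemma wreath_finite (F : groupType) (X : choiceType) (H : groupType)
    (a : group_action H X) (s : seq F) (P : seq X) (E : seq H) :
  (forall c, c \in s) -> exists L : seq (wreath F a),
    forall w : wreath F a, (forall x, w.1 x != 1 -> x \in P) -> w.2 \in E -> w \in L.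
Proof.
move=> sP; elim: P => [|y P [L LP]].
  exists [seq wreath_base F a e | e <- E] => w wP wE; apply/mapP; exists w.2 => //.
  apply: wreath_eq => // x; rewrite fsfunE; apply/eqP/negPn/negP => /wP.
  by rewrite in_nil.
exists [seq wreath_lamp a y c * w | c <- s, w <- L] => w wP wE.
pose v : wreath F a := wreath_lamp a y (w.1 y)^-1 * w.
have -> : w = wreath_lamp a y (w.1 y) * v.
  by rewrite /v mulgA -wreath_lampM mulgV wreath_lamp1 mul1g.
apply: (allpairs_f (fun c w => wreath_lamp a y c * w)) => //.
apply: LP; last by rewrite /= mul1g.
move=> x; rewrite wreath_mulE wreath_lampE /= invg1 gact1.
have [->|xy] := eqVneq x y; first by rewrite mulVg eqxx.
by rewrite mul1g => /wP; rewrite inE (negPf xy).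
Qed.

(** * Quasi-isometries of wreath products *)

Section WreathMap.
Variables (G H : groupType) (M : set G) (N : set H).
Hypotheses (nM : normal_subgroup M) (nN : normal_subgroup N).
Local Notation X := (cosets M).
Local Notation Y := (cosets N).
Local Notation aM := (coset_rmul_action nM).
Local Notation aN := (coset_rmul_action nN).
Variables (A B : groupType) (I J : finType) (p : I -> nat) (q : J -> nat).
Variables (encA : A -> I -> nat) (decA : (I -> nat) -> A).
Variables (encB : B -> J -> nat) (decB : (J -> nat) -> B).
Hypotheses (codA : coding p encA decA) (codB : coding q encB decB).
Variables (f : G -> H) (fb : X -> Y) (h : X * I -> Y * J) (k : Y * J -> X * I).
Hypotheses (fc : coarse_map f).
Hypothesis fbf : close aN (fb \o left_coset_of M) (left_coset_of N \o f).
Hypotheses (kK : cancel k h).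
Hypothesis (fbh : close aN (fb \o fst) (fst \o h)).

Definition wreath_map (u : wreath A (coset_action M)) :
  wreath B (coset_action N) := (transport h k encA decB u.1, f u.2).

(** Uniformity in [g] is the point: [g] is near [g] times a representative of [x], since [P] is
    finite; then [f] is coarse, [fb] follows [f] on cosets, and [h] stays near [fb]. *)
Lemma local_displacement (P : seq X) : exists E : seq H, forall g x i, x \in P ->
  exists2 e, e \in E &
    (h (left_mul_coset g x, i)).1 = left_coset_of N (f g * e).
Proof.
pose T := {t : G * (X * I) | t.2.1 \in P}.
pose base (t : T) := (sval t).1; pose pos (t : T) := (sval t).2.1.
pose target (t : T) := (left_mul_coset (base t) (pos t), (sval t).2.2).
have [E fE] : close aN (left_coset_of N \o f \o base) (fst \o h \o target).
  have near_pos : near base (fun t => base t * coset_repr (pos t)).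
    apply/nearP; exists [seq coset_repr x | x <- P] => t; rewrite mulKg.
    by apply: map_f; case: t.
  apply: (close_trans (near_coset nN (coarse_close fc near_pos))).
  apply: (close_trans (close_sym (close_comp _ fbf))).
  have := close_comp target fbh; congr close; apply/funext => t /=.
  by rewrite -left_mul_coset_of coset_reprK.
exists [seq e^-1 | e <- E] => g x i xP.
have [e Ee hE] := fE (exist _ (g, (x, i)) xP).
by exists e^-1; [exact: (map_f (fun e => e^-1)) | rewrite -(coset_rmulE nN); exact: hE].
Qed.

(** Right multiplication of [(c, g)] by [(c0, g0)] changes lamps only on the translate by [g] of the
    support of [c0]. Their images under [h], translated back by [f g], lie in a finite set not
    depending on [(c, g)]. *)
Lemma wreath_map_coarse (s : seq B) : (forall c, c \in s) -> coarse_map wreath_map.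
Proof.
move=> sP; apply/coarse_mapP => -[c0 g0].
have [E1 fE1] := (coarse_mapP f).1 fc g0.
have [E2 hE2] := local_displacement (finsupp c0).
have [L LP] := wreath_finite (coset_action N) [seq left_coset_of N e | e <- E2] E1 sP.
exists L => -[c g]; apply: LP => [y|]; last exact: fE1.
rewrite wreath_mulE wreath_invE /= invgK => neq.
have : transport h k encA decB c (left_mul_coset (f g) y) !=
       transport h k encA decB (((c, g) : wreath A (coset_action M)) * (c0, g0)).1
         (left_mul_coset (f g) y).
  by apply: contraNneq neq => <-; rewrite mulVg.
move=> /(transport_neq codA codB kK)[j]; rewrite wreath_mulE /=.
set z := k _ => cz.
have zsupp : left_mul_coset g^-1 z.1 \in finsupp c0.
  by rewrite mem_finsupp; apply: contraNneq cz => ->; rewrite mulg1.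
have [e Ee] := hE2 g (left_mul_coset g^-1 z.1) z.2 zsupp.
rewrite -left_mul_cosetM mulgV left_mul_coset1 -surjective_pairing kK /=.
move=> /(congr1 (left_mul_coset (f g)^-1)).
rewrite -left_mul_cosetM mulVg left_mul_coset1 left_mul_coset_of mulKg => ->.
exact: map_f.
Qed.

End WreathMap.

Lemma near_wreath (F : groupType) (X : choiceType) (H : groupType)
    (a : group_action H X) (T : Type) (u v : T -> wreath F a) :
  (forall t, (u t).1 = (v t).1) -> near (fun t => (u t).2) (fun t => (v t).2) ->
  near u v.
Proof.
move=> uv1 /nearP[E uv]; apply/nearP; exists [seq wreath_base F a e | e <- E] => t.
apply/mapP; exists ((u t).2^-1 * (v t).2); rewrite ?uv //.
apply: wreath_eq => // x.
by rewrite wreath_mulE wreath_invE fsfunE /= invgK uv1 mulVg.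
Qed.

Theorem proposition1p7 (R : realType) (n m : nat) (G H : groupType)
    (M : set G) (N : set H) (S : {fset G}) (T : {fset H}) :
  2 <= n -> 2 <= m ->
  generates S -> generates T ->
  normal_subgroup M -> normal_subgroup N ->
  ~ co_amenable R M ->
  (exists f : G -> H,
     quasi_isometry_of_pairs (word_dist R S) M (word_dist R T) N f) ->
  (forall p : nat, prime p -> (p %| n) = (p %| m)) ->
  forall (U : {fset lamplighter n M}) (V : {fset lamplighter m N}),
    generates U -> generates V ->
    exists f : lamplighter n M -> lamplighter m N,
      quasi_isometry (word_dist R U) (word_dist R V) f.
Proof.
move=> n2 m2 Sgen Tgen nM nN nam [f0 f0pairs] nm U V Ugen Vgen.
have [f' [[fc f'c f'f ff'] [fMN f'NM]]] :=
  pairs_coset_compatible Sgen Tgen nM nN f0pairs.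
move: f0 f'f ff' fc fMN {f0pairs} => f f'f ff' fc fMN.
pose fb := coset_map M N f; pose gb := coset_map N M f'.
have fbc : coarse _ _ fb := coset_map_coarse nM fc fMN.
have gbc : coarse _ _ gb := coset_map_coarse nN f'c f'NM.
have gfb := coset_map_cancel f'c fMN f'NM f'f.
have fgb := coset_map_cancel fc f'NM fMN ff'.
have [s [sp sn sE]] := prime_factors (ltnW n2).
have [t [tp tn tE]] := prime_factors (ltnW m2).
have st : s =i t.
  by move=> p; rewrite sE tE; case pp : (prime p) => //=; apply: nm.
(* Each position goes to the first position of the same prime in the other list. *)
have idx (r r' : seq nat) : r =i r' -> exists w : 'I_(size r) -> 'I_(size r'),
    (fun j => nth 0%N r' j) \o w =1 (fun i => nth 0%N r i).
  move=> rr'; have /choice[w wP] (i : 'I_(size r)) :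
      exists j : 'I_(size r'), nth 0%N r' j = nth 0%N r i.
    have ir' : nth 0%N r i \in r' by rewrite -rr' mem_nth.
    by exists (Ordinal (etrans (index_mem _ _) ir')); rewrite /= nth_index.
  by exists w.
have [w wP] := idx s t st; have [w' w'P] := idx t s (fsym st).
have [h [k [hK kK hp fbh]]] :=
  local_bijection fbc gbc gfb fgb (co_amenable_expand nM Sgen nam) wP w'P.
have [encA [decA codA]] := Zp_coding n2 sp sn.
have [encB [decB codB]] := Zp_coding m2 tp tn.
have kp z : nth 0%N s (k z).2 = nth 0%N t z.2 by rewrite -hp kK.
(* As [h] stays near [fb], its inverse [k] stays near the coarse inverse [gb]. *)
have gbk : close (coset_rmul_action nM) (gb \o fst) (fst \o k).
  apply: (close_trans (v := gb \o (fb \o fst) \o k)).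
    apply: close_sym; have := close_comp k (coarse_close gbc fbh).
    by congr close; apply/funext => z /=; rewrite kK.
  exact: (close_comp (fst \o k) gfb).
exists (wreath_map encA decB f h k).
(* On configurations the two transports are exact inverses; only the cursors are displaced, by a
   bounded amount. *)
apply: (@coarse_equivalence_qi R _ _ _ _ Ugen Vgen _ (wreath_map encB decA f' k h)).
- apply: (wreath_map_coarse codA codB fc (coset_map_close fMN) kK fbh (s := enum 'Z_m)).
  by move=> c; rewrite mem_enum.
- apply: (wreath_map_coarse codB codA f'c (coset_map_close f'NM) hK gbk (s := enum 'Z_n)).
  by move=> c; rewrite mem_enum.
- apply: near_wreath => [u|] /=; first exact: (transportK codA codB hK kK hp).
  exact: (close_comp snd f'f).
- apply: near_wreath => [u|] /=; first exact: (transportK codB codA kK hK kp).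
  exact: (close_comp snd ff').
Qed.
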